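(* Let $\delta \ge 0$ and let $X$ be a $\delta$-hyperbolike graph with base vertex $x$. For each integer $n\ge 0$ let $X_n$ be the ball of radius $n$ about $x$ in $X$. Let $Y$ be any finite connected graph, and let $$b_Y(t) := \sum_{n\ge 0} (Y|X_n)\, t^n$$ be the generating function whose coefficient of $t^n$ is the number $(Y|X_n)$ of distinct embeddings of $Y$ as a complete subgraph of $X_n$. Then $b_Y(t)$ is rational, i.e. it is the power series expansion of a rational function of $t$.
   Context: A connected graph $X$ of finite valence is called $\delta$-hyperbolike (for some $\delta\ge 0$) if (1) $X$, with its path metric $d$ in which every edge has length $1$, is $\delta$-hyperbolic (each side of every geodesic triangle lies in the $\delta$-neighborhood of the union of the other two sides), and (2) the automorphism group $\mathrm{Aut}(X)$ acts transitively on the vertices of $X$. The base vertex $x$ is an arbitrary vertex. $X_n$ is the complete (i.e. full, induced) subgraph of $X$ spanned by the vertices at distance $\le n$ from $x$. For finite graphs $Y,Z$, $(Y|Z)$ denotes the number of distinct embeddings of $Y$ as a complete subgraph of $Z$, i.e. the number of maps that are graph isomorphisms from $Y$ onto an induced subgraph of $Z$. *)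

(* Defs.v *)
From HB Require Import structures.
From mathcomp Require Import all_boot all_order all_algebra.
From mathcomp Require Import finmap.
From mathcomp Require Import all_classical all_reals.

Set Implicit Arguments.
Unset Strict Implicit.
Unset Printing Implicit Defensive.

Import Order.TTheory GRing.Theory Num.Theory.

Local Open Scope classical_set_scope.
Local Open Scope ring_scope.

Record graph (V : choiceType) := Graph {
  adj :> rel V;
  adj_sym : symmetric adj;
  adj_irr : irreflexive adj
}.

Definition graph_connected (V : choiceType) (X : graph V) : Prop :=
  forall u v : V, exists2 p : seq V, path X u p & last u p = v.

Definition finite_valence (V : choiceType) (X : graph V) : Prop :=
  forall v : V, finite_set [set w | X v w].

Definition automorphism (V : choiceType) (X : graph V) (f : V -> V) : Prop :=
  bijective f /\ forall u v : V, X (f u) (f v) = X u v.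

Definition vertex_transitive (V : choiceType) (X : graph V) : Prop :=
  forall u v : V, exists2 f : V -> V, automorphism X f & f u = v.

(* Points of the geometric realization are given by their barycentric
   coordinates on the vertices. In particular edge_pt u v 0 = vertex_pt u,
   edge_pt u v 1 = vertex_pt v and edge_pt u v s = edge_pt v u (1 - s), so that
   no quotient is needed. *)
Definition vertex_pt (R : realType) (V : choiceType) (v : V) : V -> R :=
  fun w => (w == v)%:R.

Definition edge_pt (R : realType) (V : choiceType) (u v : V) (s : R) : V -> R :=
  fun w => (1 - s) * vertex_pt R u w + s * vertex_pt R v w.

Definition realization (R : realType) (V : choiceType) (X : graph V) :
    set (V -> R) :=
  [set p | (exists v : V, p = vertex_pt R v) \/
           exists (u v : V) (s : R), [/\ X u v, 0 <= s <= 1 & p = edge_pt u v s]].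

(* pl_path X p q l: there is a path of length l from p to q that is a
   concatenation of finitely many straight segments, each inside a closed edge
   identified with [0, 1]. *)
Inductive pl_path (R : realType) (V : choiceType) (X : graph V) :
    (V -> R) -> (V -> R) -> R -> Prop :=
| pl_nil p : pl_path X p p 0
| pl_cons (u v : V) (s t : R) (q : V -> R) (l : R) :
    X u v -> 0 <= s <= 1 -> 0 <= t <= 1 ->
    pl_path X (edge_pt u v t) q l ->
    pl_path X (edge_pt u v s) q (`|s - t| + l).

(* inf is 0 on the empty set, so this is the path metric only when X is
   connected. *)
Definition path_dist (R : realType) (V : choiceType) (X : graph V)
    (p q : V -> R) : R :=
  inf [set l | pl_path X p q l].

Definition geodesic (R : realType) (V : choiceType) (X : graph V)
    (p q : V -> R) (S : set (V -> R)) : Prop :=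
  exists (L : R) (c : R -> V -> R),
    [/\ 0 <= L, c 0 = p, c L = q, S = c @` [set s | 0 <= s <= L] &
        S `<=` realization X /\
        forall s t : R, 0 <= s <= L -> 0 <= t <= L ->
          path_dist X (c s) (c t) = `|s - t|].

Definition neighborhood (R : realType) (V : choiceType) (X : graph V)
    (delta : R) (S : set (V -> R)) : set (V -> R) :=
  [set p | exists2 q, S q & path_dist X p q <= delta].

Definition hyperbolic (R : realType) (V : choiceType) (X : graph V)
    (delta : R) : Prop :=
  forall (p q r : V -> R) (S1 S2 S3 : set (V -> R)),
    geodesic X p q S1 -> geodesic X q r S2 -> geodesic X r p S3 ->
    [/\ S1 `<=` neighborhood X delta (S2 `|` S3),
        S2 `<=` neighborhood X delta (S3 `|` S1) &
        S3 `<=` neighborhood X delta (S1 `|` S2)].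

Definition hyperbolike (R : realType) (V : choiceType) (X : graph V)
    (delta : R) : Prop :=
  [/\ graph_connected X, finite_valence X, hyperbolic X delta &
      vertex_transitive X].

Definition vertex_ball (R : realType) (V : choiceType) (X : graph V)
    (x : V) (n : nat) : set V :=
  [set v | path_dist X (vertex_pt R x) (vertex_pt R v) <= n%:R].

(* The isomorphisms of Y onto an induced subgraph of the subgraph of X induced
   by B. *)
Definition embeddings (T : finType) (Y : graph T) (V : choiceType)
    (X : graph V) (B : set V) : set {ffun T -> V} :=
  [set f : {ffun T -> V} |
    [/\ injective f, forall a, B (f a) & forall a b, X (f a) (f b) = Y a b]].

(* fset_set sends infinite sets to fset0; here the set is finite as soon as B
   is. *)
Definition embedding_count (T : finType) (Y : graph T) (V : choiceType)
    (X : graph V) (B : set V) : nat :=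
  #|` fset_set (embeddings Y X B)|.

(* The identity q * (\sum_n b_n t^n) = p of formal power series, with q
   invertible as a power series. *)
Definition rational_series (b : nat -> rat) : Prop :=
  exists p q : {poly rat},
    q`_0 != 0 /\ forall n : nat, \sum_(i < n.+1) q`_i * b (n - i)%N = p`_n.

(* Main.v *)
(** Following Cannon, let the cone of a vertex [v] be the set of the vertices
    that some geodesic from the base vertex [x] reaches through [v], and consider
    the function [u |-> d(x, u) - d(x, v)] on the [D]-neighborhood of that cone,
    up to automorphisms of [X]. By thinness of triangles, for every [u] in this
    neighborhood some geodesic from [x] to [u] meets a ball about [v] of fixed
    radius; hence the function is determined by its values on that ball, and
    there are finitely many classes. The class of [v] determines the number of
    its successors of each class, the number of its predecessors, and, if [D]
    exceeds the diameter of [Y], the number of embeddings of [Y] whose first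
    vertex farthest from [x] is sent to [v]. Double counting the edges between
    consecutive spheres gives a linear recurrence for the number of vertices of
    each class in the spheres, and Cayley-Hamilton turns it into rationality. *)

Require Import Defs.
From HB Require Import structures.
From mathcomp Require Import all_boot all_order all_algebra.
From mathcomp Require Import finmap.
From mathcomp Require Import all_classical all_reals.
From mathcomp Require Import zify lra.

Set Implicit Arguments.
Unset Strict Implicit.
Unset Printing Implicit Defensive.

Import Order.TTheory GRing.Theory Num.Theory.

Local Open Scope classical_set_scope.
Local Open Scope ring_scope.

(** * Linear recurrences *)

(** By Cayley-Hamilton the characteristic polynomial of [A] annihilates the sequence; its reciprocal
    polynomial serves as denominator. *)
Lemma rational_series_linear m (z : nat -> 'rV[rat]_m.+1) (A : 'M[rat]_m.+1)
    (w : 'cV[rat]_m.+1) :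
  (forall n, z n.+1 = z n *m A) ->
  rational_series (fun n => (z n *m w) 0 0).
Proof.
move=> zS; pose c := char_poly A.
have szc : size c = m.+2 by rewrite size_char_poly.
have zE n k : z (n + k)%N = z n *m A ^+ k.
  elim: k => [|k IHk]; first by rewrite addn0 expr0 mulmx1.
  by rewrite addnS zS IHk exprSr mulmxA.
have CH n : \sum_(i < m.+2) c`_i * (z (n + i)%N *m w) 0 0 = 0.
  have := Cayley_Hamilton A; rewrite /horner_mx /horner_morph.
  rewrite -/c (@horner_coef_wide _ m.+2) ?size_map_poly ?szc // => c0.
  transitivity ((z n *m (0 : 'M_m.+1) *m w) 0 0); last by rewrite mulmx0 mul0mx mxE.
  rewrite -c0 mulmx_sumr mulmx_suml summxE; apply: eq_bigr => i _.
  rewrite coef_map /= zE -[_%:M * _]/(_ *m _) mul_scalar_mx.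
  by rewrite -scalemxAr -scalemxAl [RHS]mxE.
pose b n := (z n *m w) 0 0.
(* Reversing [c] turns [CH k] into the vanishing of the coefficient of index [m.+1 + k] in the
   product. The constant coefficient of [q] is the leading one of [c], which is 1. *)
pose q : {poly rat} := \poly_(j < m.+2) c`_(m.+1 - j).
exists (\poly_(n < m.+1) (\sum_(i < n.+1) q`_i * b (n - i)%N)), q.
split.
  rewrite coef_poly /= subn0.
  by have /monicP := char_poly_monic A; rewrite lead_coefE szc => ->; apply: oner_neq0.
move=> n; rewrite coef_poly; case: ltnP => // ltmn.
have [k ->] : exists k, n = (m.+1 + k)%N by exists (n - m.+1)%N; rewrite subnKC.
rewrite -[LHS]/(\sum_(i < m.+2 + k) q`_i * b (m.+1 + k - i)%N).
rewrite big_split_ord /= [X in _ + X]big1 ?addr0; last first.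
  by move=> i _; rewrite coef_poly ltnNge leq_addr /= mul0r.
rewrite -[RHS](CH k) [RHS](reindex_inj rev_ord_inj) /=.
apply: eq_bigr => i _; rewrite coef_poly ltn_ord subSS; congr (_ * _).
by rewrite /b; congr ((z _ *m w) 0 0); have := ltn_ord i; lia.
Qed.

(** The running sum [b] is adjoined to the state as an extra coordinate and read off by a linear
    functional. This also keeps the matrix nonempty when [K = 0]. *)
Lemma rational_series_recurrence K (s : nat -> 'I_K -> rat) (b : nat -> rat)
    (A : 'I_K -> 'I_K -> rat) (w : 'I_K -> rat) :
  (forall n j, s n.+1 j = \sum_i s n i * A i j) ->
  (forall n, b n.+1 = b n + \sum_i s n.+1 i * w i) ->
  rational_series b.
Proof.
move=> sS bS.
pose sm n : 'rV_K := \row_i s n i; pose wm : 'cV_K := \col_i w i.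
pose Am : 'M_K := \matrix_(i, j) A i j.
have smS n : sm n.+1 = sm n *m Am.
  by apply/rowP => j; rewrite !mxE sS; apply: eq_bigr => i _; rewrite !mxE.
pose z n : 'rV[rat]_(1 + K) := row_mx (b n)%:M (sm n).
(* The increment of [b] involves [s n.+1], that is [sm n *m Am], whence the block [Am *m wm]. *)
pose B : 'M[rat]_(1 + K) := block_mx 1%:M 0 (Am *m wm) Am.
have zS n : z n.+1 = z n *m B.
  rewrite mul_row_block mulmx0 add0r mulmx1 -smS mulmxA -smS; congr row_mx.
  apply/rowP => j; rewrite bS ord1 !mxE /= mulr1n.
  by congr (_ + _); apply: eq_bigr => i _; rewrite !mxE.
have zE n : (z n *m (col_mx 1%:M 0 : 'cV_(1 + K))) 0 0 = b n.
  by rewrite mul_row_col mulmx1 mulmx0 addr0 mxE.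
have [p [q [q0 pq]]] := rational_series_linear (col_mx 1%:M 0 : 'cV_(1 + K)) zS.
exists p, q; split => // n; rewrite -pq.
by apply: eq_bigr => i _; rewrite -[b _]zE.
Qed.

(** * The combinatorial distance *)

(** Agrees with [path_dist] on the vertices of a connected graph ([path_dist_vertex]), where the
    default branch is never taken. *)
Definition gdist (V : choiceType) (X : graph V) (u v : V) : nat :=
  if pselect (exists n, `[<exists p, [/\ path X u p, last u p = v & size p = n]>])
  is left exn then ex_minn exn else 0.

Section GraphDistance.
Context (V : choiceType) (X : graph V).
Context (X_conn : graph_connected X).
Local Notation d := (gdist X).

Lemma gdistP u v : exists p, [/\ path X u p, last u p = v & size p = d u v].
Proof.
rewrite /gdist; case: pselect => [exn|nex]; first by case: ex_minnP => n /asboolP.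
by case: nex; have [p pp lp] := X_conn u v; exists (size p); apply/asboolP; exists p.
Qed.

Lemma gdist_last_le u p : path X u p -> (d u (last u p) <= size p)%N.
Proof.
rewrite /gdist => pp; case: pselect => // exn; case: ex_minnP => n _; apply.
by apply/asboolP; exists p.
Qed.

Lemma gdistxx u : d u u = 0%N.
Proof. by apply/eqP; rewrite -leqn0; apply: (@gdist_last_le u [::]). Qed.

Lemma gdist_eq0 u v : d u v = 0%N -> u = v.
Proof. by have [p [_ <- <-]] := gdistP u v; case: p. Qed.

Lemma gdist_triangle u v w : (d u w <= d u v + d v w)%N.
Proof.
have [p [pp lp <-]] := gdistP u v; have [q [pq lq <-]] := gdistP v w.
have := @gdist_last_le u (p ++ q).
by rewrite cat_path pp lp pq last_cat lp lq size_cat; apply.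
Qed.

Lemma gdist_sym_le u v : (d v u <= d u v)%N.
Proof.
have [p [pp <- <-]] := gdistP u v.
have := @gdist_last_le (last u p) (rev (belast u p)).
rewrite rev_path (eq_path (e' := X)); last by move=> a b; rewrite adj_sym.
move=> /(_ pp); rewrite size_rev size_belast.
by case: p {pp} => [|b p] //=; rewrite rev_cons last_rcons.
Qed.

Lemma gdist_sym u v : d u v = d v u.
Proof. by apply/eqP; rewrite eqn_leq !gdist_sym_le. Qed.

Lemma gdist_adj u v : X u v -> (d u v <= 1)%N.
Proof. by move=> uv; apply: (@gdist_last_le u [:: v]) => /=; rewrite uv. Qed.

Lemma gdist1_adj u v : d u v = 1%N -> X u v.
Proof.
move=> duv; have [p [pp lp sp]] := gdistP u v; rewrite duv in sp.
by case: p sp pp lp => [|w [|]] //= _ /andP[+ _] <-.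
Qed.

Lemma gdist_mid u v k : (k <= d u v)%N ->
  exists2 w, d u w = k & (d u v = k + d w v)%N.
Proof.
move=> ku; have [p [pp lp sp]] := gdistP u v.
pose w := last u (take k p).
have ptd : path X u (take k p) && path X w (drop k p).
  by rewrite -cat_path cat_take_drop.
have /andP[pt pd] := ptd.
have ldw : last w (drop k p) = v by rewrite -last_cat cat_take_drop.
have := gdist_last_le pt; have := gdist_last_le pd; rewrite ldw -/w.
rewrite size_take_min size_drop sp; have := gdist_triangle u w v.
by move=> ? ? ?; exists w; lia.
Qed.

Lemma gdist_ball_finite : finite_valence X ->
  forall u n, finite_set [set v | (d u v <= n)%N].
Proof.
move=> X_fin u; elim=> [|n IHn].
  apply: (sub_finite_set (B := [set u])) => // v /=.
  by rewrite leqn0 => /eqP/gdist_eq0 ->.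
apply: (sub_finite_set (B := [set v | (d u v <= n)%N] `|`
    \bigcup_(w in [set v | (d u v <= n)%N]) [set v | X w v])).
  move=> v /=; rewrite leq_eqVlt => /orP[/eqP duv|]; last by left.
  have [|w duw dwv] := @gdist_mid u v n; first by rewrite duv.
  right; exists w => /=; first by rewrite duw.
  by apply: gdist1_adj; lia.
rewrite finite_setU; split => //; apply: bigcup_finite => // w _; exact: X_fin.
Qed.

End GraphDistance.

(** * Automorphisms as isometries *)

Section Automorphisms.
Context (V : choiceType) (X : graph V).
Context (X_conn : graph_connected X).
Local Notation d := (gdist X).

Lemma automorphism_id : automorphism X id.
Proof. by split => //; exists id. Qed.

Lemma automorphism_comp f g :
  automorphism X f -> automorphism X g -> automorphism X (g \o f).
Proof.
by move=> [bf af] [bg ag]; split; [exact: bij_comp | move=> u v /=; rewrite ag].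
Qed.

Lemma automorphism_inv f : automorphism X f ->
  exists g, [/\ cancel f g, cancel g f & automorphism X g].
Proof.
move=> [[g fK gK] af]; exists g; split => //; split; first by exists f.
by move=> u v; rewrite -af !gK.
Qed.

Lemma gdist_automorphism f u v : automorphism X f -> d (f u) (f v) = d u v.
Proof.
have le g a b : automorphism X g -> (d (g a) (g b) <= d a b)%N.
  move=> [_ ag]; have [p [pp <- <-]] := gdistP X_conn a b.
  rewrite -last_map -(size_map g); apply: gdist_last_le.
  by rewrite path_map (eq_path (e' := X)).
move=> af; apply/eqP; rewrite eqn_leq le //=.
have [g [fK _ ag]] := automorphism_inv af.
by rewrite -{1}[u]fK -{1}[v]fK le.
Qed.

End Automorphisms.

(** * Thin triangles of vertices *)

Section Realization.
Context (R : realType) (V : choiceType) (X : graph V).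
Context (X_conn : graph_connected X).
Implicit Types (p q : V -> R) (u v : V).
Local Notation d := (gdist X).

Lemma edge_pt0 u v : edge_pt u v (0 : R) = vertex_pt R u.
Proof. by apply/funext => w; rewrite /edge_pt subr0 mul1r mul0r addr0. Qed.

Lemma edge_pt1 u v : edge_pt u v (1 : R) = vertex_pt R v.
Proof. by apply/funext => w; rewrite /edge_pt subrr mul1r mul0r add0r. Qed.

Lemma edge_pt_gt0 u v (s : R) a : X u v -> 0 <= s <= 1 -> 0 < edge_pt u v s a ->
  (a = u /\ edge_pt u v s a = 1 - s) \/ (a = v /\ edge_pt u v s a = s).
Proof.
move=> uv s01; have nuv : u != v by apply: contraTneq uv => ->; rewrite adj_irr.
rewrite /edge_pt /vertex_pt.
have [<-|nua] := eqVneq u a.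
  by left; split => //; rewrite ?eqxx (negPf nuv) mulr1 mulr0 addr0.
have [<-|nva] := eqVneq v a.
  by right; split => //; rewrite mulr1 mulr0 add0r.
by rewrite !mulr0 addr0 ltxx.
Qed.

(** Covers arbitrary [u] and [v], since at the end of a path the second vertex used by [path_pt] is
    only the default value of [nth]. *)
Lemma edge_pt_gt0l u v (s : R) : 0 <= s < 1 -> 0 < edge_pt u v s u.
Proof.
move=> s01; rewrite /edge_pt /vertex_pt eqxx mulr1.
by case: eqP => _; rewrite ?mulr1 ?mulr0; lra.
Qed.

Lemma pl_path_trans p q r (l m : R) :
  pl_path X p q l -> pl_path X q r m -> pl_path X p r (l + m).
Proof.
elim=> [p0|u v s t q0 l0 uv s01 t01 _ IH] qr; first by rewrite add0r.
by rewrite -addrA; apply: pl_cons => //; apply: IH.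
Qed.

Lemma pl_path_segment u v (s t : R) : X u v -> 0 <= s <= 1 -> 0 <= t <= 1 ->
  pl_path X (edge_pt u v s) (edge_pt u v t) `|s - t|.
Proof.
move=> uv s01 t01; rewrite -[ `|_| ]addr0; apply: pl_cons => //; exact: pl_nil.
Qed.

Lemma pl_path_sym p q (l : R) : pl_path X p q l -> pl_path X q p l.
Proof.
elim=> [p0|u v s t q0 l0 uv s01 t01 _ IH]; first exact: pl_nil.
by rewrite addrC distrC; apply: (pl_path_trans IH); apply: pl_path_segment.
Qed.

Lemma pl_path_ge0 p q (l : R) : pl_path X p q l -> 0 <= l.
Proof. by elim=> // *; apply: addr_ge0. Qed.

(* If [a] is a vertex of the cell containing [p], then [p] lies at distance
   [1 - p a] from it. *)
Lemma pl_path_ge_gdist p q (l : R) a b : realization X q -> pl_path X p q l ->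
  0 < p a -> 0 < q b -> (d a b)%:R <= (1 - p a) + l + (1 - q b).
Proof.
move=> + pq; elim: pq a => {p q l} [p|u v s t q l uv s01 t01 _ IH] a.
  case=> [[v ->]|[u [v [s [uv s01 ->]]]]].
    rewrite /vertex_pt; case: (eqVneq a v) => [->|]; last by rewrite ltxx.
    case: (eqVneq b v) => [->|]; last by rewrite ltxx.
    by rewrite gdistxx // subrr !addr0.
  have := gdist_adj uv; rewrite -(ler_nat R) => duv.
  move=> /(edge_pt_gt0 uv s01)[][-> ->] /(edge_pt_gt0 uv s01)[][-> ->];
    rewrite ?gdistxx ?[d v u]gdist_sym //; lra.
move=> rq pa qb; have := gdist_adj uv; rewrite -(ler_nat R) => duv.
have IHu := IH u rq; have IHv := IH v rq.
have euv : (d u b)%:R <= (d u v)%:R + (d v b)%:R :> R.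
  by rewrite -natrD ler_nat gdist_triangle.
have evu : (d v b)%:R <= (d u v)%:R + (d u b)%:R :> R.
  by rewrite (gdist_sym X_conn u v) -natrD ler_nat gdist_triangle.
have nuv : u != v by apply: contraTneq uv => ->; rewrite adj_irr.
have eu : edge_pt u v t u = 1 - t.
  by rewrite /edge_pt /vertex_pt eqxx (negPf nuv) mulr1 mulr0 addr0.
have ev : edge_pt u v t v = t.
  by rewrite /edge_pt /vertex_pt eqxx (eq_sym v) (negPf nuv) mulr1 mulr0 add0r.
rewrite eu in IHu; rewrite ev in IHv.
have ns1 := ler_norm (s - t); have ns2 := ler_norm (t - s).
rewrite distrC in ns2.
(* The induction hypothesis applies to the vertices with positive coordinate at the intermediate
   point: both ends inside the open edge, a single one at an endpoint. *)
case: (ltrP 0 t) => t0; case: (ltrP t 1) => t1.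
- have {}IHu := IHu ltac:(lra) qb; have {}IHv := IHv t0 qb.
  by case: (edge_pt_gt0 uv s01 pa) => -[-> ->]; lra.
- have {}IHv := IHv t0 qb.
  by case: (edge_pt_gt0 uv s01 pa) => -[-> ->]; lra.
- have {}IHu := IHu ltac:(lra) qb.
  by case: (edge_pt_gt0 uv s01 pa) => -[-> ->]; lra.
- by lra.
Qed.

Lemma pl_path_vertex_ge u v (l : R) :
  pl_path X (vertex_pt R u) (vertex_pt R v) l -> (d u v)%:R <= l.
Proof.
move=> /pl_path_ge_gdist => /(_ u v).
rewrite /vertex_pt !eqxx subrr add0r addr0; apply => //.
by left; exists v.
Qed.

Lemma path_dist_le p q (l : R) : pl_path X p q l -> path_dist X p q <= l.
Proof. by move=> pq; apply: ge_inf => //; exists 0 => m; apply: pl_path_ge0. Qed.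

Lemma path_dist_unique p q (l : R) : pl_path X p q l ->
  (forall m, pl_path X p q m -> l <= m) -> path_dist X p q = l.
Proof.
move=> pq lmin; apply/eqP; rewrite eq_le path_dist_le //=.
by apply: lb_le_inf; first by exists l.
Qed.

Lemma path_dist_lt p q (l e : R) : pl_path X p q l -> 0 < e ->
  exists2 m, pl_path X p q m & m < path_dist X p q + e.
Proof.
move=> pq e0; apply: inf_adherent => //.
by split; [exists l | exists 0 => m; apply: pl_path_ge0].
Qed.

(** * Edge paths as curves in the realization *)

Section GeodesicPath.
Context (a : V) (w : seq V).
Context (w_path : path X a w).
Local Notation z := (nth a (a :: w)).

(** Arc length parametrization. At an integer the second vertex has weight 0, so the default value
    of [nth] past the end does not matter. *)
Definition path_pt (s : R) : V -> R :=
  edge_pt (z (Num.truncn s)) (z (Num.truncn s).+1) (s - (Num.truncn s)%:R).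

Lemma path_pt_nat i : path_pt i%:R = vertex_pt R (z i).
Proof. by rewrite /path_pt natrK subrr edge_pt0. Qed.

Lemma path_pt0 : path_pt 0 = vertex_pt R a.
Proof. exact: (path_pt_nat 0). Qed.

(** At [s = i.+1] truncation already moves to the next edge; the two descriptions agree at the
    common vertex. *)
Lemma path_ptE i (s : R) : i%:R <= s <= i.+1%:R ->
  path_pt s = edge_pt (z i) (z i.+1) (s - i%:R).
Proof.
rewrite [s <= _]le_eqVlt => /andP[is_ /orP[/eqP ->|si]].
  by rewrite path_pt_nat -natrB // subSnn edge_pt1.
by rewrite /path_pt (truncn_def (n := i)) // is_.
Qed.

Lemma path_pt_adj i : (i < size w)%N -> X (z i) (z i.+1).
Proof. by move=> iw; have /(pathP a) := w_path; apply. Qed.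

(** Induction on the number of initial edges allowed; a piece that crosses the vertex of index [n]
    is cut there. *)
Lemma path_pt_pl_path n (s t : R) : (n <= size w)%N -> 0 <= s -> s <= t ->
  t <= n%:R -> pl_path X (path_pt s) (path_pt t) (t - s).
Proof.
elim: n s t => [|n IHn] s t nw s0 st tn.
  have -> : t = s by lra.
  by rewrite subrr; apply: pl_nil.
have seg (s' t' : R) : n%:R <= s' -> s' <= t' -> t' <= n.+1%:R ->
    pl_path X (path_pt s') (path_pt t') (t' - s').
  move=> ns' st' tn'; rewrite -natr1 in tn'.
  rewrite (@path_ptE n s'); last by rewrite -natr1; lra.
  rewrite (@path_ptE n t'); last by rewrite -natr1; lra.
  have -> : t' - s' = `|(s' - n%:R) - (t' - n%:R)|.
    by rewrite distrC ger0_norm; lra.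
  by apply: pl_path_segment; [exact: path_pt_adj | lra | lra].
have [tn'|/ltW nt] := lerP t n%:R; first by apply: IHn => //; exact: ltnW.
have [sn|/ltW ns] := lerP s n%:R; last exact: seg.
have -> : t - s = (n%:R - s) + (t - n%:R) by lra.
apply: (pl_path_trans (q := path_pt n%:R)); last by apply: seg.
by apply: IHn => //; exact: ltnW.
Qed.

Context (w_geod : d a (last a w) = size w).

Lemma path_pt_last : path_pt (size w)%:R = vertex_pt R (last a w).
Proof. by rewrite path_pt_nat (last_nth a). Qed.

(** A shorter connection between two points, completed by the outer pieces of the path, would join
    the ends by less than their distance. *)
Lemma path_dist_path_pt (s t : R) : 0 <= s <= (size w)%:R ->
  0 <= t <= (size w)%:R -> path_dist X (path_pt s) (path_pt t) = `|s - t|.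
Proof.
wlog st : s t / s <= t.
  move=> H s0 t0; have /orP[st|ts] := le_total s t; first exact: H.
  rewrite distrC -(H t s) //; congr inf; apply/seteqP.
  by split => l /=; apply: pl_path_sym.
move=> s0 t0; rewrite distrC ger0_norm ?subr_ge0 //.
apply: path_dist_unique => [|l stl].
  by apply: (@path_pt_pl_path (size w)) => //; lra.
have p1 : pl_path X (path_pt 0) (path_pt s) (s - 0).
  by apply: (@path_pt_pl_path (size w)) => //; lra.
have p2 : pl_path X (path_pt t) (path_pt (size w)%:R) ((size w)%:R - t).
  by apply: (@path_pt_pl_path (size w)) => //; lra.
have := pl_path_trans p1 (pl_path_trans stl p2).
rewrite path_pt_last path_pt0.
by move=> /pl_path_vertex_ge; rewrite w_geod; lra.
Qed.

Lemma path_pt_realization (s : R) : 0 <= s <= (size w)%:R ->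
  realization X (path_pt s).
Proof.
move=> /andP[s0 sw]; have := truncn_itv s0; set i := Num.truncn s => si.
have [iw|wi] := ltnP i (size w).
  right; exists (z i), (z i.+1), (s - i%:R).
  rewrite -natr1 in si; rewrite path_pt_adj //; split => //; lra.
have -> : s = (size w)%:R.
  by apply/eqP; rewrite eq_le sw (le_trans _ (andP si).1) // ler_nat.
by left; exists (last a w); rewrite path_pt_last.
Qed.

Definition path_image : set (V -> R) :=
  path_pt @` [set s | 0 <= s <= (size w)%:R].

Lemma geodesic_path_image :
  geodesic X (vertex_pt R a) (vertex_pt R (last a w)) path_image.
Proof.
exists (size w)%:R, path_pt; split=> //.
- exact: path_pt0.
- exact: path_pt_last.
- split; last exact: path_dist_path_pt.
  by move=> _ [s /path_pt_realization ? <-].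
Qed.

Lemma gdist_nth_geodesic i : (i <= size w)%N ->
  (d a (z i) + d (z i) (last a w) = d a (last a w))%N.
Proof.
move=> iw; have := w_path; rewrite -{1}(cat_take_drop i w) cat_path.
have zl : last a (take i w) = z i.
  rewrite (last_nth a) size_take_min (minn_idPl iw).
  by case: i iw => //= i iw; rewrite nth_take.
have ll : last (z i) (drop i w) = last a w.
  by rewrite -zl -last_cat cat_take_drop.
move=> /andP[/gdist_last_le]; rewrite zl => h1 /gdist_last_le; rewrite ll.
have := gdist_triangle X_conn a (z i) (last a w).
by move: h1; rewrite size_take_min size_drop w_geod; lia.
Qed.

End GeodesicPath.

Lemma pl_path_gdist u v : pl_path X (vertex_pt R u) (vertex_pt R v) (d u v)%:R.
Proof.
have [w [pw lw <-]] := gdistP X_conn u v.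
have := path_pt_pl_path pw (leqnn _) (lexx 0) (ler0n _ _) (lexx _).
by rewrite path_pt0 path_pt_last subr0 lw.
Qed.

(** One unit of the added 2 pays for moving from [q] to a vertex of its edge, the other for
    approximating the infimum that defines [path_dist]. *)
Lemma path_image_near a w v (delta : R) q : path X a w ->
  path_image a w q -> path_dist X (vertex_pt R v) q <= delta ->
  exists2 i, (i <= size w)%N & (d v (nth a (a :: w) i))%:R < delta + 2.
Proof.
move=> pw [s /= sw <-{q}] vs; have /andP[s0 sl] := sw.
have := truncn_itv s0; set i := Num.truncn s => si.
have iw : (i <= size w)%N.
  by rewrite -(ler_nat R); apply: le_trans sl; case/andP: si.
exists i => //; set b := nth _ _ _.
have zs : 0 < path_pt a w s b by apply: edge_pt_gt0l; rewrite -natr1 in si; lra.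
have va := pl_path_gdist v a.
have as_ := path_pt_pl_path pw (leqnn _) (lexx 0) s0 sl.
rewrite path_pt0 in as_.
have [m pm mlt] := path_dist_lt (pl_path_trans va as_) ltr01.
have := pl_path_ge_gdist (path_pt_realization pw sw) pm _ zs => /(_ v).
rewrite /vertex_pt eqxx subrr => /(_ ltr01).
by lra.
Qed.

(** Hyperbolicity restated for vertices: thinness puts [v] close to a point of another side, and
    [path_image_near] replaces that point by a vertex. *)
Lemma thin_gdist (delta : R) : hyperbolic X delta ->
  exists N : nat, forall a c u v, (d a v + d v c = d a c)%N ->
  exists2 z, (d v z <= N)%N &
    (d a z + d z u = d a u)%N \/ (d c z + d z u = d c u)%N.
Proof.
move=> hyp; exists (Num.truncn (delta + 2)) => a c u v avc.
have [p1 [pp1 lp1 sp1]] := gdistP X_conn a v.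
have [p2 [pp2 lp2 sp2]] := gdistP X_conn v c.
have [w2 [pw2 lw2 sw2]] := gdistP X_conn c u.
have [w3 [pw3 lw3 sw3]] := gdistP X_conn u a.
(* The side from [a] to [c] is chosen to pass through [v]; the hypothesis makes this concatenation
   geodesic. *)
pose w1 := p1 ++ p2.
have pw1 : path X a w1 by rewrite cat_path pp1 lp1.
have lw1 : last a w1 = c by rewrite last_cat lp1.
have sw1 : d a (last a w1) = size w1 by rewrite lw1 size_cat; lia.
have g1 := geodesic_path_image pw1 sw1.
have g2 := @geodesic_path_image c w2 pw2; rewrite lw2 in g2.
have g3 := @geodesic_path_image u w3 pw3; rewrite lw3 in g3.
rewrite lw1 in g1.
have [+ _ _] := hyp _ _ _ _ _ _ g1 (g2 (esym sw2)) (g3 (esym sw3)).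
move=> /(_ (vertex_pt R v))[].
  exists (size p1)%:R; first by rewrite /= ler0n ler_nat size_cat leq_addr.
  rewrite path_pt_nat; congr vertex_pt.
  by rewrite -cat_cons nth_cat /= ltnSn -last_nth lp1.
move=> q [] qS vq.
  have [i iw vi] := path_image_near pw2 qS vq.
  exists (nth c (c :: w2) i).
    by rewrite truncn_ge_nat; [exact: ltW | exact: le_trans (ler0n _ _) (ltW vi)].
  by right; have := @gdist_nth_geodesic c w2 pw2; rewrite lw2; apply.
have [i iw vi] := path_image_near pw3 qS vq.
exists (nth u (u :: w3) i).
  by rewrite truncn_ge_nat; [exact: ltW | exact: le_trans (ler0n _ _) (ltW vi)].
left; have := @gdist_nth_geodesic u w3 pw3; rewrite lw3 => /(_ (esym sw3) i iw).
set z := nth _ _ _.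
by rewrite (gdist_sym X_conn a z) (gdist_sym X_conn z u) (gdist_sym X_conn a u); lia.
Qed.

Lemma path_dist_vertex u v :
  path_dist X (vertex_pt R u) (vertex_pt R v) = (d u v)%:R.
Proof.
apply: path_dist_unique => [|l]; first exact: pl_path_gdist.
exact: pl_path_vertex_ge.
Qed.

Lemma vertex_ballE x n : vertex_ball R X x n = [set v | (d x v <= n)%N].
Proof.
by rewrite /vertex_ball; apply/eq_set => v; rewrite path_dist_vertex ler_nat.
Qed.

End Realization.

(** * Cone types *)

(** The code may separate equivalent vertices, so a class is named by the code of one canonically
    chosen representative. *)
Lemma finite_classification (V : choiceType) (E : V -> V -> Prop) (C : finType)
    (code : V -> C) :
  (forall v, E v v) -> (forall v v', E v v' -> E v' v) ->
  (forall v1 v2 v3, E v1 v2 -> E v2 v3 -> E v1 v3) ->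
  (forall v v', code v = code v' -> E v v') ->
  exists (K : nat) (k : V -> 'I_K), forall v v', k v = k v' <-> E v v'.
Proof.
move=> Er Es Et codeP; pose rep v := choose (fun w => `[<E v w>]) v.
have Erep v : E v (rep v).
  by apply/asboolP; apply: (chooseP (P := fun w => `[<E v w>])); apply/asboolP.
exists #|C|, (fun v => enum_rank (code (rep v))) => v v'; split.
  move=> /enum_rank_inj/codeP vv'.
  exact: Et (Et _ _ _ (Erep v) vv') (Es _ _ (Erep v')).
move=> vv'; congr (enum_rank (code _)); rewrite /rep.
have eqE : (fun w => `[<E v w>]) =1 (fun w => `[<E v' w>]).
  by move=> w; apply/asbool_equiv_eq; split; apply: Et => //; exact: Es.
(* The choice still carries a starting point, [v] or [v']; both satisfy the predicate, so
   [choose_id] identifies the results. *)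
by rewrite (eq_choose eqE); apply: choose_id; apply/asboolP => //; exact: Es.
Qed.

Section ConeTypes.
Context (V : choiceType) (X : graph V) (x : V) (D : nat).
Context (X_conn : graph_connected X) (D_gt0 : (0 < D)%N).
Local Notation d := (gdist X).
Local Notation lev := (gdist X x).
Implicit Types (u v w c : V) (f g : V -> V).

(** Equality in the triangle inequality: [v] lies on a geodesic from [x] to [c]. *)
Definition cone v c : Prop := (lev c = lev v + d v c)%N.

Definition cone_nbhd v u : Prop := exists2 c, cone v c & (d c u <= D)%N.

(* [f] preserves [lev u - lev v]; sums are compared because subtraction on [nat]
   is truncated. *)
Definition cone_iso f v v' : Prop :=
  [/\ automorphism X f, f v = v' &
    forall u, cone_nbhd v u \/ cone_nbhd v' (f u) ->
      (lev (f u) + lev v = lev u + lev v')%N].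

Definition same_cone_type v v' : Prop := exists f, cone_iso f v v'.

Lemma cone_refl v : cone v v.
Proof. by rewrite /cone gdistxx // addn0. Qed.

Lemma cone_sub_nbhd v c : cone v c -> cone_nbhd v c.
Proof. by move=> vc; exists c => //; rewrite gdistxx. Qed.

Lemma ball_sub_nbhd v u : (d v u <= D)%N -> cone_nbhd v u.
Proof. by move=> vu; exists v => //; exact: cone_refl. Qed.

Lemma cone_iso_nbhd f v v' u :
  cone_iso f v v' -> cone_nbhd v u -> cone_nbhd v' (f u).
Proof.
move=> [af fv fl] [c vc cu]; exists (f c); last by rewrite gdist_automorphism.
have := fl c (or_introl (cone_sub_nbhd vc)).
by rewrite /cone -fv gdist_automorphism //; move: vc; rewrite /cone; lia.
Qed.

(** Inversion exchanges the two alternatives of the disjunction in [cone_iso]. *)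
Lemma cone_iso_inv f v v' : cone_iso f v v' ->
  exists g, [/\ cancel f g, cancel g f & cone_iso g v' v].
Proof.
move=> [af fv fl]; have [g [fK gK ag]] := automorphism_inv af.
exists g; split => //; split => //; first by rewrite -fv fK.
move=> u gu; have := fl (g u); rewrite gK => /(_ (proj1 (or_comm _ _) gu)); lia.
Qed.

Lemma same_cone_type_refl v : same_cone_type v v.
Proof. by exists id; split => //; exact: automorphism_id. Qed.

Lemma same_cone_type_sym v v' : same_cone_type v v' -> same_cone_type v' v.
Proof. by move=> [f /cone_iso_inv[g [_ _ ?]]]; exists g. Qed.

Lemma same_cone_type_trans v2 v1 v3 :
  same_cone_type v1 v2 -> same_cone_type v2 v3 -> same_cone_type v1 v3.
Proof.
move=> [f ff] [g gg]; exists (g \o f).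
have [af fv fl] := ff; have [ag gv gl] := gg.
have [g' [gK g'K gg']] := cone_iso_inv gg.
split; [exact: automorphism_comp | by rewrite /= fv gv | ].
have mid u : cone_nbhd v2 (f u) ->
    (lev (g (f u)) + lev v1 = lev u + lev v3)%N.
  by move=> u2; have := fl u (or_intror u2); have := gl _ (or_introl u2); lia.
move=> u /= [/(cone_iso_nbhd ff)|/(cone_iso_nbhd gg')]; first exact: mid.
by rewrite gK; apply: mid.
Qed.

Lemma cone_succ v w c : X v w -> lev w = (lev v).+1 -> cone w c -> cone v c.
Proof.
rewrite /cone => /gdist_adj vw lw wc.
by have := gdist_triangle X_conn v w c; have := gdist_triangle X_conn x v c; lia.
Qed.

(** As [D > 0], the neighborhood contains [w], which fixes the level of [f w]. The cone of a
    successor lies in that of [v], so the same [f] serves for [w]. *)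
Lemma cone_iso_succ f v v' w : cone_iso f v v' -> X v w -> lev w = (lev v).+1 ->
  [/\ X v' (f w), lev (f w) = (lev v').+1 & cone_iso f w (f w)].
Proof.
move=> [af fv fl] vw lw; have dvw := gdist_adj vw.
have fvw : X v' (f w) by rewrite -fv; case: af => _ ->.
have lfw : lev (f w) = (lev v').+1.
  have := fl w (or_introl (ball_sub_nbhd (leq_trans dvw D_gt0))); lia.
split => //; split => // u fu.
suff : (lev (f u) + lev v = lev u + lev v')%N by lia.
apply: fl; case: fu => -[c wc cu]; [left|right]; exists c => //.
  exact: cone_succ vw lw wc.
exact: cone_succ fvw lfw wc.
Qed.

(** A predecessor of [w] lies outside the cone of [w] but in its neighborhood, as [D > 0]; hence the
    type also controls the number of predecessors. *)
Lemma cone_iso_pred f v v' w : cone_iso f w v' -> X v w -> lev w = (lev v).+1 ->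
  X (f v) v' /\ lev v' = (lev (f v)).+1.
Proof.
move=> [af fv fl]; rewrite adj_sym => wv lw; rewrite -fv adj_sym.
split; first by case: af => _ ->.
have := fl v (or_introl (ball_sub_nbhd (leq_trans (gdist_adj wv) D_gt0))).
by rewrite fv; lia.
Qed.

(** * Finiteness of the number of cone types *)

Context (N0 : nat).
Context (X_thin : forall a c u v, (d a v + d v c = d a c)%N ->
  exists2 z, (d v z <= N0)%N &
    (d a z + d z u = d a u)%N \/ (d c z + d z u = d c u)%N).

(** If thinness yields [z] on the side from [c] to [u], then [d c z <= D], so [c] is within [N0 + D]
    of [v], and [u] within [N0 + D + D]. *)
Let N := (N0 + D + D)%N.

(** Thinness for the triangle [x], [c], [u] with [v] on the side from [x] to [c]: either a geodesic
    from [x] to [u] passes near [v], or [u] is itself near [v]. *)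
Lemma cone_nbhd_factor v u : cone_nbhd v u ->
  exists2 z, (d v z <= N)%N & (lev u = lev z + d z u)%N.
Proof.
move=> [c vc cu]; have [z vz [zu|zu]] := X_thin u (esym vc).
  by exists z; rewrite /N; lia.
exists u; last by rewrite gdistxx ?addn0.
have := gdist_triangle X_conn v z u; have := gdist_triangle X_conn v c u.
have := gdist_triangle X_conn v z c; rewrite (gdist_sym X_conn z c) /N; lia.
Qed.

(** The finite data that decide a cone type, by [ball_iso_cone_iso]. *)
Definition ball_iso f v v' : Prop :=
  [/\ automorphism X f, f v = v' &
    forall u, (d v u <= N)%N -> (lev (f u) + lev v = lev u + lev v')%N].

Lemma ball_iso_inv f v v' : ball_iso f v v' ->
  exists g, [/\ cancel f g, cancel g f & ball_iso g v' v].
Proof.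
move=> [af fv fl]; have [g [fK gK ag]] := automorphism_inv af.
exists g; split => //; split => //; first by rewrite -fv fK.
move=> u vu; rewrite -{2}[u]gK fl //.
by rewrite -(gdist_automorphism X_conn _ _ af) gK fv.
Qed.

(** A geodesic to [u] through a vertex [z] of the ball bounds the level of [f u] by way of [f z].
    The reverse inequality comes from the inverse, once [f u] is known to be in the neighborhood of
    [v']. *)
Lemma ball_iso_le f v v' u : ball_iso f v v' -> cone_nbhd v u ->
  (lev (f u) + lev v <= lev u + lev v')%N.
Proof.
move=> [af fv fl] /cone_nbhd_factor[z vz zu].
have := gdist_triangle X_conn x (f z) (f u).
by rewrite gdist_automorphism //; have := fl z vz; lia.
Qed.

Lemma ball_iso_ge f v v' u : ball_iso f v v' -> cone_nbhd v' (f u) ->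
  (lev u + lev v' <= lev (f u) + lev v)%N.
Proof.
move=> /ball_iso_inv[g [fK gK gg]] /(ball_iso_le gg); rewrite fK; lia.
Qed.

(** Induction along a geodesic from [v] to [c]: the previous vertex goes into the cone of [v'], so
    [f c] is within [1 <= D] of that cone and both inequalities hold. *)
Lemma ball_iso_cone f v v' c : ball_iso f v v' -> cone v c -> cone v' (f c).
Proof.
move=> ff; have [af fv _] := ff.
move: {2}(d v c) (leqnn (d v c)) => k; elim: k c => [|k IHk] c.
  by rewrite leqn0 => /eqP/(gdist_eq0 X_conn) <- _; rewrite fv; exact: cone_refl.
rewrite leq_eqVlt => /orP[/eqP vc|]; last exact: IHk.
move=> Kc; have [|c' vc' cc'] := @gdist_mid _ _ X_conn v c k; first by lia.
have Kc' : cone v c'.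
  move: Kc; rewrite /cone; have := gdist_triangle X_conn x v c'.
  have := gdist_triangle X_conn x c' c; lia.
have fc : cone_nbhd v' (f c).
  exists (f c'); first by apply: IHk => //; rewrite vc'.
  by rewrite gdist_automorphism //; lia.
have := ball_iso_le ff (cone_sub_nbhd Kc); have := ball_iso_ge ff fc.
by move: Kc; rewrite /cone -fv gdist_automorphism //; lia.
Qed.

Lemma ball_iso_nbhd f v v' u :
  ball_iso f v v' -> cone_nbhd v u -> cone_nbhd v' (f u).
Proof.
move=> ff [c /(ball_iso_cone ff) fc cu]; exists (f c) => //.
by have [af _ _] := ff; rewrite gdist_automorphism.
Qed.

Lemma ball_iso_cone_iso f v v' : ball_iso f v v' -> cone_iso f v v'.
Proof.
move=> ff; have [af fv _] := ff; have [g [fK gK gg]] := ball_iso_inv ff.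
split => // u fu; apply/eqP; rewrite eqn_leq; apply/andP; split.
  apply: ball_iso_le => //; case: fu => // /(ball_iso_nbhd gg).
  by rewrite fK.
by apply: ball_iso_ge => //; case: fu => // /(ball_iso_nbhd ff).
Qed.

Context (X_fin : finite_valence X) (X_trans : vertex_transitive X).

(** Transitivity carries all balls of radius [N] to the one about [x], where the level differences
    take finitely many values. *)
Lemma same_cone_type_finite :
  exists (K : nat) (k : V -> 'I_K), forall v v', k v = k v' <-> same_cone_type v v'.
Proof.
have /choice[F FP] : forall v, exists f, automorphism X f /\ f x = v.
  by move=> v; have [f af fx] := X_trans x v; exists f.
pose B := fset_set [set u | (d x u <= N)%N].
have BP u : (u \in B) = (d x u <= N)%N.
  rewrite in_fset_set; last exact: gdist_ball_finite.
  by apply/idP/idP; rewrite in_setE.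
(* Level differences lie between [-N] and [N]; the shift by [N] keeps them natural and at most
   [N + N], so [inord] loses nothing. *)
pose code v : {ffun B -> 'I_(N + N).+1} :=
  [ffun z => inord (lev (F v (val z)) + N - lev v)].
apply: (@finite_classification _ _ _ code).
- exact: same_cone_type_refl.
- exact: same_cone_type_sym.
- move=> v1 v2 v3; exact: same_cone_type_trans.
move=> v v' vv'; have [av Fv] := FP v; have [av' Fv'] := FP v'.
have [g [fK gK ag]] := automorphism_inv av.
exists (F v' \o g); apply: ball_iso_cone_iso; split.
- exact: automorphism_comp.
- by rewrite /= -{1}Fv fK.
move=> u vu /=; have xgu : (d x (g u) <= N)%N.
  by rewrite -(gdist_automorphism X_conn _ _ av) gK Fv.
have gB : g u \in B by rewrite BP.
have /ffunP/(_ [` gB]%fset) := vv'; rewrite !ffunE /= gK => /(congr1 val) /=.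
have h1 w w' : (lev w <= lev w' + d w' w)%N by exact: gdist_triangle.
have d' : (d v' (F v' (g u)) <= N)%N.
  by rewrite -{1}Fv' gdist_automorphism.
have := h1 (F v' (g u)) v'; have := h1 v' (F v' (g u)).
have := h1 u v; have := h1 v u; rewrite (gdist_sym X_conn u v).
rewrite (gdist_sym X_conn (F v' _) v') => ? ? ? ?.
by rewrite !inordK; lia.
Qed.

End ConeTypes.

(** * Counting *)

Lemma card_fset_set_le (T U : choiceType) (g : T -> U) (A : set T) (B : set U) :
  injective g -> finite_set A -> finite_set B -> (forall a, A a -> B (g a)) ->
  (#|` fset_set A| <= #|` fset_set B|)%N.
Proof.
move=> g_inj Afin Bfin AB.
have <- : #|` (g @` fset_set A)%fset| = #|` fset_set A| by rewrite card_imfset.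
apply/fsubset_leq_card/fsubsetP => _ /imfsetP[a /= + ->].
by rewrite !in_fset_set // !in_setE; apply: AB.
Qed.

Lemma sum_fset_set_sub (A : zmodType) (T : choiceType) (B C : set T) (P : pred T)
    (F : T -> A) : finite_set B -> (forall w, C w <-> B w /\ P w) ->
  \sum_(w <- fset_set C) F w = \sum_(w <- fset_set B | P w) F w.
Proof.
move=> Bfin CE; have Cfin : finite_set C by apply: sub_finite_set Bfin => w /CE[].
rewrite [RHS]big_fset_condE; apply: eq_fbig => // w.
rewrite !inE in_fset_set // in_fset_set //=.
apply/idP/idP; rewrite in_setE; first by case/CE => Bw ->; rewrite andbT in_setE.
by case/andP; rewrite in_setE => Bw Pw; apply/CE.
Qed.

Lemma card_fset_set_sum (T : choiceType) (B C : set T) (P : pred T) :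
  finite_set B -> (forall w, C w <-> B w /\ P w) ->
  (#|` fset_set C|%:R : rat) = \sum_(w <- fset_set B | P w) 1.
Proof.
move=> Bfin CE; rewrite -(sum_fset_set_sub _ Bfin CE).
by rewrite card_fset_sum1 natr_sum.
Qed.

Lemma sum_by_class (T : Type) K (k : T -> 'I_K) (r : seq T) (G : 'I_K -> rat) :
  \sum_i (\sum_(v <- r) (k v == i)%:R) * G i = \sum_(v <- r) G (k v).
Proof.
under eq_bigr do rewrite mulr_suml.
rewrite exchange_big /=; apply: eq_bigr => v _.
rewrite (bigD1 (k v)) //= eqxx mul1r big1 ?addr0 // => i.
by rewrite eq_sym => /negPf ->; rewrite mul0r.
Qed.

Lemma factor_through (T A : Type) (C : eqType) (k : T -> C) (F : T -> A) (a : A) :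
  (forall v v', k v = k v' -> F v = F v') -> exists G, forall v, F v = G (k v).
Proof.
move=> FP; have /choice[G GP] : forall c, exists b, forall v, k v = c -> F v = b.
  move=> c; have [[v <-]|nc] := pselect (exists v, k v = c).
    by exists (F v) => v' /FP.
  by exists a => v vc; case: nc; exists v.
by exists G => v; apply: GP.
Qed.

Lemma finite_ffun_set (T : finType) (V : choiceType) (B : set V) :
  finite_set B -> finite_set [set f : {ffun T -> V} | forall a, B (f a)].
Proof.
move=> Bfin; pose g (h : {ffun T -> fset_set B}) : {ffun T -> V} :=
  [ffun a => val (h a)].
apply: (sub_finite_set (B := g @` setT)); last exact/finite_image/finite_finset.
move=> f fB; have fB' a : f a \in fset_set B by rewrite in_fset_set // in_setE.
by exists [ffun a => [` fB' a]%fset] => //; apply/ffunP => a; rewrite !ffunE.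
Qed.

Section Counting.
Context (V : choiceType) (X : graph V) (x : V).
Context (X_conn : graph_connected X) (X_fin : finite_valence X).
Local Notation d := (gdist X).
Local Notation lev := (gdist X x).

Definition successors (P : pred V) v : set V :=
  [set w | [/\ X v w, lev w = (lev v).+1 & P w]].

Definition predecessors w : set V := [set v | X v w /\ lev w = (lev v).+1].

Lemma sphere_finite n : finite_set [set v | lev v = n].
Proof.
apply: sub_finite_set (gdist_ball_finite X_conn X_fin x n) => v /= ->.
exact: leqnn.
Qed.

Lemma successors_finite P v : finite_set (successors P v).
Proof. by apply: sub_finite_set (X_fin v) => w []. Qed.

Lemma predecessors_finite w : finite_set (predecessors w).
Proof. by apply: sub_finite_set (X_fin w) => v []; rewrite adj_sym. Qed.

Lemma predecessors_gt0 w n : lev w = n.+1 -> (0 < #|` fset_set (predecessors w)|)%N.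
Proof.
move=> lw; have [|v lv vw] := @gdist_mid _ _ X_conn x w n; first by rewrite lw.
rewrite cardfs_gt0; apply/fset0Pn; exists v.
rewrite in_fset_set; last exact: predecessors_finite.
rewrite in_setE; split; last by rewrite lv lw.
by apply: (gdist1_adj X_conn); lia.
Qed.

Context (K : nat) (k : V -> 'I_K) (M : 'I_K -> 'I_K -> rat) (P : 'I_K -> rat).
Context (succE : forall v j,
  #|` fset_set (successors (fun w => k w == j) v)|%:R = M (k v) j).
Context (predE : forall w, #|` fset_set (predecessors w)|%:R = P (k w)).

Definition sphere_count n j : rat :=
  \sum_(v <- fset_set [set v | lev v = n]) (k v == j)%:R.

(* Double counting of the edges from the sphere of radius [n] to vertices of
   class [j] in the next one: every such vertex has [P j > 0] predecessors. *)
Lemma sphere_count_rec n j :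
  sphere_count n.+1 j = \sum_i sphere_count n i * (M i j / P j).
Proof.
rewrite (sum_by_class k _ (fun i => M i j / P j)).
rewrite /sphere_count; set S' := fset_set [set v | lev v = n.+1].
have SE m v : v \in fset_set [set v | lev v = m] -> lev v = m.
  by rewrite in_fset_set ?in_setE //; exact: sphere_finite.
(* Each edge into class [j] has weight [(P j)^-1], so the edges into one vertex contribute 1 in
   total. *)
transitivity (\sum_(v <- fset_set [set v | lev v = n])
    \sum_(w <- S' | X v w && (k w == j)) (P j)^-1); last first.
  apply: eq_fbigr => v /SE lv _; rewrite -succE.
  rewrite (@card_fset_set_sum _ _ _ (fun w => X v w && (k w == j)) (sphere_finite n.+1)).
    by rewrite mulr_suml; apply: eq_bigr => w _; rewrite mul1r.
  move=> w; rewrite /successors /= lv; split; first by move=> [-> -> ->].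
  by move=> [-> /andP[-> ->]].
rewrite (exchange_big_dep (fun w => k w == j)) /=; last by move=> v w _ /andP[].
rewrite [LHS](eq_bigr (fun w => if k w == j then 1 else 0)); last first.
  by move=> w _; case: (k w == j).
rewrite -big_mkcond /=; apply: eq_fbigr => w /SE lw /eqP kw.
rewrite kw eqxx; under [RHS]eq_bigl do rewrite andbT.
(* Class [j] is attained at the positive level [n.+1], by [w], which therefore has a predecessor. *)
have Pj0 : P j != 0.
  by rewrite -kw -predE pnatr_eq0 -lt0n; exact: predecessors_gt0 lw.
rewrite -[LHS](mulfV Pj0) -{1}kw -predE.
rewrite (@card_fset_set_sum _ _ _ (fun v => X v w) (sphere_finite n)).
  by rewrite mulr_suml; apply: eq_bigr => v _; rewrite mul1r.
move=> v; rewrite /predecessors /= lw; split; first by move=> [-> [->]].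
by move=> [-> ->].
Qed.

End Counting.

Lemma gdist_embedding (T : finType) (Y : graph T) (V : choiceType) (X : graph V)
    (f : T -> V) a b : graph_connected Y -> (forall a b, X (f a) (f b) = Y a b) ->
  (gdist X (f a) (f b) <= gdist Y a b)%N.
Proof.
move=> Y_conn fY; have [p [pp <- <-]] := gdistP Y_conn a b.
rewrite -last_map -(size_map f); apply: gdist_last_le.
by rewrite path_map (eq_path (e' := Y)).
Qed.

(** * Embeddings sorted by their farthest vertex *)

Section Embeddings.
Context (V : choiceType) (X : graph V) (x : V) (T : finType) (Y : graph T).
Context (X_conn : graph_connected X) (X_fin : finite_valence X).
Context (Y_conn : graph_connected Y) (a0 : T).
Local Notation d := (gdist X).
Local Notation lev := (gdist X x).
Implicit Types (f : {ffun T -> V}).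

(** The choice depends only on comparisons of levels, so it is invariant under maps that preserve
    level differences. *)
Definition top f : T :=
  odflt a0 [pick a | [forall b, (lev (f b) <= lev (f a))%N]].

Lemma lev_top f b : (lev (f b) <= lev (f (top f)))%N.
Proof.
rewrite /top; case: pickP => [a /forallP/(_ b) //|/=].
case: (@arg_maxnP T a0 xpredT (fun a => lev (f a)) isT) => a _ amax /(_ a) /negP[].
by apply/forallP => c; exact: amax.
Qed.

Definition embeddings_topped v : set {ffun T -> V} :=
  [set f | embeddings Y X setT f /\ f (top f) = v].

(** Plays the role of [D]: the diameter of [Y], increased by 1 to be positive. *)
Definition span : nat := (\max_(p : T * T) gdist Y p.1 p.2).+1.

Lemma embeddings_topped_ball v f a : embeddings_topped v f ->
  (d v (f a) <= span)%N.
Proof.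
move=> [[_ _ fY] <-]; apply: leqW.
apply: leq_trans (gdist_embedding _ _ Y_conn fY) _.
exact: (leq_bigmax (F := fun p : T * T => gdist Y p.1 p.2) (top f, a)).
Qed.

Lemma embeddings_topped_finite v : finite_set (embeddings_topped v).
Proof.
have := @finite_ffun_set T V _ (gdist_ball_finite X_conn X_fin v span).
apply: sub_finite_set.
by move=> f fv a; exact: embeddings_topped_ball.
Qed.

(** The image of [f] lies in the ball of radius [span] about [v], where [g] preserves level
    differences; hence the same element of [T] is on top. *)
Lemma embeddings_topped_iso g v v' f : cone_iso X x span g v v' ->
  embeddings_topped v f -> embeddings_topped v' [ffun a => g (f a)].
Proof.
move=> [[bg ag] gv gl] fv; have [[f_inj _ fY] ft] := fv; split.
  split => // [a b|a b]; last by rewrite !ffunE ag.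
  by rewrite !ffunE => /(bij_inj bg)/f_inj.
have gE a : (lev (g (f a)) + lev v = lev (f a) + lev v')%N.
  by apply: gl; left; apply: ball_sub_nbhd => //; exact: embeddings_topped_ball.
rewrite ffunE -gv -ft; congr (g (f _)); rewrite /top; congr odflt.
apply: eq_pick => a; apply: eq_forallb => b; rewrite !ffunE.
by have := gE a; have := gE b; lia.
Qed.

(** An embedding lands in the ball exactly when its farthest vertex does. *)
Lemma embedding_count_ball n :
  ((embedding_count Y X [set v | (lev v <= n)%N])%:R : rat) =
  \sum_(v <- fset_set [set v | (lev v <= n)%N]) #|` fset_set (embeddings_topped v)|%:R.
Proof.
have Bfin := gdist_ball_finite X_conn X_fin x n.
set B := [set v | _] in Bfin *.
have Efin : finite_set (embeddings Y X B).
  have := @finite_ffun_set T V _ Bfin.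
  by apply: sub_finite_set => f [].
rewrite (@card_fset_set_sum _ _ _ xpredT Efin); last by move=> f; split => // -[].
transitivity (\sum_(f <- fset_set (embeddings Y X B))
    \sum_(v <- fset_set B | f (top f) == v) (1 : rat)).
  apply: eq_fbigr => f; rewrite in_fset_set // in_setE => -[_ fB _] _.
  under eq_bigl do rewrite eq_sym.
  rewrite (fbig_pred1_inj (k := id)) //.
  by rewrite in_fset_set // in_setE.
rewrite (exchange_big_dep xpredT) //=; apply: eq_fbigr => v.
rewrite in_fset_set // in_setE => Bv _.
rewrite (@card_fset_set_sum _ _ _ (fun f => f (top f) == v) Efin) //.
move=> f; split => [[[f_inj _ fY] ft]|[[f_inj _ fY] /eqP ft]]; last by split.
split; last exact/eqP; split => // a.
by rewrite /B /=; apply: leq_trans (lev_top f a) _; rewrite ft.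
Qed.

End Embeddings.

(** * Rationality of the generating function *)

Lemma sum_ball_succ (V : choiceType) (X : graph V) (x : V) (F : V -> rat) n :
  graph_connected X -> finite_valence X ->
  \sum_(v <- fset_set [set v | (gdist X x v <= n.+1)%N]) F v =
  \sum_(v <- fset_set [set v | (gdist X x v <= n)%N]) F v +
  \sum_(v <- fset_set [set v | gdist X x v = n.+1]) F v.
Proof.
move=> X_conn X_fin; have Bfin := gdist_ball_finite X_conn X_fin x n.+1.
rewrite (bigID (fun v => (gdist X x v <= n)%N)) /=; congr (_ + _); apply/esym.
  by apply: sum_fset_set_sub => // v /=; split => [vn|[]//]; split => //; exact: leqW.
by apply: sum_fset_set_sub => // v /=; lia.
Qed.

Theorem theorem2p9 (R : realType) (delta : R) (V : choiceType) (X : graph V)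
    (x : V) (T : finType) (Y : graph T) :
  0 <= delta -> hyperbolike X delta -> graph_connected Y ->
  rational_series (fun n => (embedding_count Y X (vertex_ball R X x n))%:R).
Proof.
move=> _ [X_conn X_fin X_hyp X_trans] Y_conn.
have [N0 X_thin] := thin_gdist X_conn X_hyp.
case: (pickP (fun a : T => true)) => [a0 _|T0]; last first.
  (* For empty [Y] the count does not depend on the ball: a constant sequence, with no class at
     all. *)
  apply: (@rational_series_recurrence 0 (fun _ _ => 0) _ (fun _ _ => 0)
    (fun _ => 0)) => [n []//|n].
  rewrite big_ord0 addr0 /embedding_count.
  have ET B : embeddings Y X B = embeddings Y X setT.
    by apply/seteqP; split=> f [fi _ fY]; split=> // a; have := T0 a.
  by rewrite (ET (vertex_ball R X x n.+1)) (ET (vertex_ball R X x n)).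
have [K [k kP]]  :=
  same_cone_type_finite x (D := span Y) X_conn isT X_thin X_fin X_trans.
have classE v v' : k v = k v' -> exists g, cone_iso X x (span Y) g v v' by move/kP.
have kiso g v v' : cone_iso X x (span Y) g v v' -> k v = k v'.
  by move=> gi; apply/kP; exists g.
have cone_inj g v v' : cone_iso X x (span Y) g v v' -> injective g.
  by move=> [[/bij_inj]].
(* Two vertices of one class are related by isomorphisms in both directions, so injections suffice
   for equal cardinalities. *)
have eq_card (U : choiceType) (C : V -> set U) :
    (forall v, finite_set (C v)) ->
    (forall g v v', cone_iso X x (span Y) g v v' ->
       exists2 h : U -> U, injective h & forall u, C v u -> C v' (h u)) ->
    exists G : 'I_K -> rat, forall v, #|` fset_set (C v)|%:R = G (k v).
  move=> Cfin CP; apply: (factor_through 0) => v v' kv.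
  congr (_%:R); apply/eqP; rewrite eqn_leq; apply/andP; split.
    have [g /CP[h h_inj hC]] := classE _ _ kv; exact: card_fset_set_le hC.
  have [g /CP[h h_inj hC]] := classE _ _ (esym kv); exact: card_fset_set_le hC.
have /choice[M0 succE] : forall j, exists G : 'I_K -> rat, forall v,
    #|` fset_set (successors X x (fun w => k w == j) v)|%:R = G (k v).
  move=> j; apply: eq_card => [v|g v v' gi]; first exact: successors_finite.
  exists g => [|w [vw lw kw]]; first exact: cone_inj gi.
  have [v'w lw' /kiso kgw] := cone_iso_succ (D := span Y) X_conn isT gi vw lw.
  by split; rewrite -?kgw.
have [P predE] : exists G : 'I_K -> rat, forall w,
    #|` fset_set (predecessors X x w)|%:R = G (k w).
  apply: eq_card => [w|g w w' gi]; first exact: predecessors_finite.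
  exists g => [|v [vw lw]]; first exact: cone_inj gi.
  exact: (cone_iso_pred (D := span Y) isT gi vw lw).
have [W topE] : exists G : 'I_K -> rat, forall v,
    #|` fset_set (embeddings_topped X x Y a0 v)|%:R = G (k v).
  apply: eq_card => [v|g v v' gi]; first exact: embeddings_topped_finite.
  exists (fun f : {ffun T -> V} => [ffun a => g (f a)]).
    move=> f1 f2 /ffunP ff; apply/ffunP => a.
    by have := ff a; rewrite !ffunE => /(cone_inj _ _ _ gi).
  by move=> f; exact: embeddings_topped_iso.
(* [M0] takes the class of the successor first, because it was chosen for each [j]. *)
pose M i j := M0 j i.
apply: (@rational_series_recurrence K (sphere_count X x k) _
  (fun i j => M i j / P j) W) => [n j|n].
  exact: sphere_count_rec.
rewrite !vertex_ballE // !(embedding_count_ball x Y X_conn X_fin a0) sum_ball_succ //.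
congr (_ + _); rewrite sum_by_class.
by apply: eq_bigr => v _; exact: topE.
Qed.
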